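(* Let $\lambda$ be a singular cardinal and let $X$ be a dense sub-inner-product-space of $\ell_2(\lambda)$. If $X$ is pathological, then there is a cardinal $\lambda'<\lambda$ such that for every cardinal $\kappa$ with $\lambda'\leq\kappa<\lambda$ the set $\{u\in[\lambda]^{\kappa^+}: X\downarrow u \text{ is pathological}\}$ is stationary in $[\lambda]^{\kappa^+}$.
   Context: The scalar field $K$ is $\mathbb{R}$ or $\mathbb{C}$. A pre-Hilbert space is an inner product space over $K$ which need not be complete; a sub-inner-product-space is a linear subspace with the restricted inner product. An orthonormal basis of a pre-Hilbert space is an orthonormal subset whose linear span is dense; a pre-Hilbert space is pathological if it has no orthonormal basis. For an infinite set $S$, $\ell_2(S)=\{\mathbf{u}:S\to K:\sum_{x\in S}|\mathbf{u}(x)|^2<\infty\}$ with inner product $(\mathbf{u},\mathbf{v})=\sum_{x}\mathbf{u}(x)\overline{\mathbf{v}(x)}$, and $\operatorname{supp}(\mathbf{u})=\{x:\mathbf{u}(x)\neq0\}$. For $X\subseteq\ell_2(S)$ and $S'\subseteq S$, $X\downarrow S'=\{\mathbf{u}\in X:\operatorname{supp}(\mathbf{u})\subseteq S'\}$ (a sub-inner-product-space when $X$ is one). $[\lambda]^{\mu}$ denotes the set of subsets of $\lambda$ of cardinality $\mu$; a subset of $[\lambda]^{\mu}$ is club if it is cofinal under $\subseteq$ and closed under unions of $\subseteq$-increasing chains of length $<\mu$, and stationary if it meets every club. *)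

(* Defs.v *)
From HB Require Import structures.
From mathcomp Require Export all_boot all_order all_algebra.
From mathcomp Require Export finmap.
From mathcomp Require Export all_classical all_reals all_analysis.
From mathcomp.analysis.showcase Require Export summability.
From mathcomp Require Export complex.
From mathcomp Require wochoice.
Export numFieldNormedType.Exports.

Set Implicit Arguments.
Unset Strict Implicit.
Unset Printing Implicit Defensive.

Import Order.TTheory GRing.Theory Num.Theory.

Local Open Scope classical_set_scope.
Local Open Scope card_scope.
Local Open Scope ring_scope.

(* The scalar field is R or C, given together with its conjugation. *)
Inductive real_or_complex (R : realType) :
    forall K : numFieldType, (K -> K) -> Prop :=
| RealScalars : real_or_complex R (K := R) (fun z => z)
| ComplexScalars : real_or_complex R (K := R[i]) (@conjc R).

(* Inner product spaces are handled as linear subspaces of an ambient vector   *)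
(* space V; ip need only be an inner product on the subspaces considered.      *)
Section PreHilbert.
Variables (K : numFieldType) (V : lmodType K) (ip : V -> V -> K).
Implicit Types X Y B : set V.

Definition subspace X Y : Prop :=
  [/\ X `<=` Y, X 0 & forall (a : K) u v, X u -> X v -> X (a *: u + v)].

Definition linear_span B : set V :=
  [set v | exists n (a : 'I_n -> K) (b : 'I_n -> V),
             (forall i, B (b i)) /\ v = \sum_(i < n) a i *: b i].

(* (w, w) < e ^+ 2 says that the norm of w is less than e. For K = R[i], 0 < e *)
(* forces e to be real.                                                        *)
Definition dense_in X Y : Prop :=
  X `<=` Y /\
  forall v, Y v -> forall e : K, 0 < e ->
    exists2 w, X w & ip (v - w) (v - w) < e ^+ 2.

Definition orthonormal B : Prop :=
  forall b c, B b -> B c -> ip b c = (b == c)%:R.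

Definition orthonormal_basis X B : Prop :=
  [/\ B `<=` X, orthonormal B & dense_in (linear_span B) X].

Definition pathological X : Prop := ~ exists B, orthonormal_basis X B.

End PreHilbert.

Section Ell2.
Variables (K : numFieldType) (conj : K -> K) (S : choiceType).
Implicit Types u v : S -> K.

Definition ell2 : set (S -> K) :=
  [set u | exists M : K, forall J : {fset S},
             partial_sum (fun x => `|u x| ^+ 2) J <= M].

(* The unordered sum is a junk value unless it converges, which it does for    *)
(* u and v in ell2.                                                            *)
Definition ell2_ip u v : K := sum (fun x => u x * conj (v x)).

Definition supp u : set S := [set x | u x != 0].

Definition down (X : set (S -> K)) (S' : set S) : set (S -> K) :=
  [set u | X u /\ supp u `<=` S'].

End Ell2.

Arguments ell2 K S : clear implicits.
Arguments ell2_ip {K} conj S.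

(* A cardinal is an initial ordinal. The cardinal lambda is given by a         *)
(* well-ordered type lam; the ordinals below lambda are the points of lam, the *)
(* ordinal a being identified with the set below a of its predecessors.        *)
Section Cardinals.
Variables (d : Order.disp_t) (lam : orderType d).
Implicit Types a k m : lam.

Definition below a : set lam := [set x | (x < a)%O].

Definition is_cardinal k : Prop :=
  forall a, (a < k)%O -> ~ (below a #= below k).

Definition cofinal_in_lam (C : set lam) : Prop :=
  forall x, exists2 c, C c & (x <= c)%O.

(* The last clause says that the cofinality of lambda is less than lambda. *)
Definition singular_cardinal : Prop :=
  [/\ wochoice.well_order (fun x y : lam => (x <= y)%O),
      forall a, ~ (below a #= [set: lam]),
      infinite_set [set: lam] &
      exists2 C : set lam, cofinal_in_lam C & ~ ([set: lam] #<= C)].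

Definition is_successor_cardinal k m : Prop :=
  [/\ is_cardinal m, (k < m)%O &
      forall a, is_cardinal a -> (k < a)%O -> (m <= a)%O].

Definition subsets_of_card m : set (set lam) := [set u | u #= below m].

(* A chain of length a is a family indexed by the ordinals below a; the empty  *)
(* chain, whose union is not of cardinality m, is excluded.                    *)
Definition club m (C : set (set lam)) : Prop :=
  [/\ C `<=` subsets_of_card m,
      forall u, subsets_of_card m u -> exists2 v, C v & u `<=` v &
      forall a (c : lam -> set lam),
        (a < m)%O -> below a !=set0 ->
        (forall x, below a x -> C (c x)) ->
        (forall x y, below a y -> (x <= y)%O -> c x `<=` c y) ->
        C (\bigcup_(x in below a) c x)].

Definition stationary m (A : set (set lam)) : Prop :=
  A `<=` subsets_of_card m /\ forall C, club m C -> A `&` C !=set0.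

End Cardinals.

(* Main.v *)
(* Call a point s approximable in G when the basis vector at s is a limit of   *)
(* vectors of X supported in G, and say that a symmetric relation E on lambda  *)
(* with countable neighbourhoods covers u when every point of u is approximable *)
(* in each E-closed set containing it. If E covers lambda, Gram-Schmidt on each *)
(* of the countable connected components of E gives an orthonormal basis of X. *)
(* If X restricted to u has an orthonormal basis, then, since a point lies in  *)
(* the supports of only countably many basis vectors, each of them countable,  *)
(* belonging to a common support is a covering relation for the points of u    *)
(* approximable in u. Relations covering countably many sets can be united, so *)
(* closing off omega times along a short cofinal subset of lambda shows that   *)
(* lambda is covered as soon as all its subsets of size < lambda are. As X is  *)
(* pathological, some u0 of size < lambda is not covered, and X restricted to  *)
(* u is pathological for all u containing u0 and the countable supports of     *)
(* vectors approximating the points of u0. So cofinality is the only property  *)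
(* of clubs that matters.                                                      *)

(* Bases of restrictions are hard to glue together, covering relations are not, so the proof trades
   one for the other. [orthonormal_basis_covers] passes from a basis of a restriction of [X] to a
   cover, [singular_compactness] glues covers of the sets of size below lambda into a cover of
   lambda, and [covers_orthonormal_basis] returns to a basis, of [X] itself.

   The first lemma covers all points approximable in a subset [g] of [u], however large [u] is. One
   uncovered set [u0] of size below lambda therefore excludes a basis for every [u] including a
   suitable [g]. As [g] is a union of countable sets indexed by [u0], it fits into sets of every
   large enough successor cardinality, and cofinality gives a member of each club that includes
   it. *)
Require Import Defs.
From mathcomp Require Import ring.
Import Order.TTheory GRing.Theory Num.Theory.
Local Open Scope classical_set_scope.

Set Implicit Arguments.
Unset Strict Implicit.
Local Existing Instance totally_filter.

(** * Cardinality in a well-ordered type *)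

Local Open Scope card_scope.

Section Injections.
Variables (T U : Type).

Lemma card_le_inj (A : set T) (B : set U) (f : T -> U) :
  (forall x, A x -> B (f x)) ->
  (forall x y, A x -> A y -> f x = f y -> x = y) -> A #<= B.
Proof.
move=> fAB finj; have {}finj : {in A &, injective f}.
  by move=> x y /set_mem Ax /set_mem Ay; exact: finj.
rewrite -(card_le_eql (inj_card_eq finj)); apply: subset_card_le => _ [x Ax <-].
exact: fAB.
Qed.

(** The default [u0], which need not lie in [B], makes the injection a total function. *)
Lemma card_le_exinj (A : set T) (B : set U) (u0 : U) : A #<= B ->
  exists2 f : T -> U, (forall x, A x -> B (f x)) &
    (forall x y, A x -> A y -> f x = f y -> x = y).
Proof.
case/card_leP => f.
pose g x := if pselect (A x) is left Ax then val (f (SigSub (mem_set Ax))) else u0.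
exists g => [x Ax|x y Ax Ay].
  by rewrite /g; case: pselect => // ?; apply: set_mem; exact: valP.
rewrite /g; case: pselect => // ax; case: pselect => // ay /val_inj.
by move=> /(@inj _ _ _ f); rewrite !inE => /(_ I I) [].
Qed.

End Injections.

Lemma card_le_setX (T T' U U' : Type) (A : set T) (A' : set T')
    (B : set U) (B' : set U') :
  A #<= A' -> B #<= B' -> A `*` B #<= A' `*` B'.
Proof.
have [A0|/set0P[a Aa]] := eqVneq A' set0.
  rewrite A0 card_le0 => /eqP -> _; rewrite set0X; exact: card_ge0.
have [B0|/set0P[b Bb]] := eqVneq B' set0.
  rewrite B0 card_le0 => _ /eqP ->; rewrite setX0; exact: card_ge0.
move=> /(card_le_exinj a)[f fA fi] /(card_le_exinj b)[g gB gi].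
apply: (card_le_inj (f := fun p => (f p.1, g p.2))) => [[x y] [/= Ax By]|].
  by split; [exact: fA|exact: gB].
move=> [x y] [x' y'] [/= Ax By] [/= Ax' By'] [/(fi _ _ Ax Ax') -> /(gi _ _ By By') ->].
by [].
Qed.

(** Hilbert's hotel: a sequence [f] in [A] is shifted by one place, which frees [f 0] for [x].
    Testing [y = x] first also handles an [x] already in [A]. *)
Lemma infinite_setU1_le (T : Type) (A : set T) (x : T) :
  infinite_set A -> A `|` [set x] #<= A.
Proof.
move=> /infiniteP /(card_le_exinj x)[f fA fi].
have {}fi m n : f m = f n -> m = n by exact: fi.
pose k y := xget 0%N [set n | f n = y].
have fk y : (exists n, f n = y) -> f (k y) = y.
  by case=> n fn; exact: (@xgetPex _ _ [set n | f n = y] (ex_intro _ n fn)).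
pose g y := if `[< y = x >] then f 0%N else
  if `[< exists n, f n = y >] then f (k y).+1 else y.
apply: (card_le_inj (f := g)) => [y|y z _ _]; rewrite /g.
  case: (asboolP (y = x)) => [_ _|yx [Ay|//]]; first exact: fA.
  by case: asboolP => // e; exact: fA.
case: (asboolP (y = x)) => [->|yx]; case: (asboolP (z = x)) => [->//|zx].
- by case: asboolP => [e /fi//|ne fz]; case: ne; exists 0%N.
- by case: asboolP => [e /fi//|ne fz]; case: ne; exists 0%N.
case: (asboolP (exists n, f n = y)) => [e|ne];
  case: (asboolP (exists n, f n = z)) => [e'|ne'] //.
- by move=> /fi [kk]; rewrite -(fk _ e) -(fk _ e') kk.
- by move=> h; case: ne'; exists (k y).+1.
- by move=> h; case: ne; exists (k z).+1.
Qed.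

(** A point goes to a chosen index of a set containing it, paired with its image under the injection
    of that set. *)
Lemma bigcup_card_le (I T U : Type) (D : set I) (F : I -> set T) (B : set U)
    (i0 : I) (b0 : U) :
  (forall i, D i -> F i #<= B) -> \bigcup_(i in D) F i #<= D `*` B.
Proof.
move=> FB.
have /choice[f fP] : forall i, exists f : T -> U, D i ->
    (forall x, F i x -> B (f x)) /\
    (forall x y, F i x -> F i y -> f x = f y -> x = y).
  move=> i; have [/FB /(card_le_exinj b0)[f fB fi]|nDi] := pselect (D i).
    by exists f.
  by exists (fun=> b0).
have /choice[j jP] : forall x, exists i, (\bigcup_(i in D) F i) x -> D i /\ F i x.
  move=> x; have [[i Di Fx]|nx] := pselect ((\bigcup_(i in D) F i) x).
    by exists i.
  by exists i0.
apply: (card_le_inj (f := fun x => (j x, f (j x) x))) => [x /jP[Dj Fj]|].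
  by split => //=; apply: (proj1 (fP _ Dj)).
move=> x y /jP[Dx Fx] /jP[Dy Fy] [jxy]; rewrite -jxy in Dy Fy *.
exact: (proj2 (fP _ Dx)).
Qed.

(* Greedy recursion along lt: each point of D picks an element of B not picked *)
(* before.                                                                     *)
Lemma transfinite_card_le (T : Type) (U : choiceType) (lt : T -> T -> Prop)
    (D : set T) (B : set U) :
  well_founded lt -> (forall x y, x <> y -> lt x y \/ lt y x) ->
  (forall x, D x -> ~ (B #<= [set y | D y /\ lt y x])) -> D #<= B.
Proof.
move=> lt_wf lt_total DB.
have [->|/set0P[x0 Dx0]] := eqVneq D set0; first exact: card_ge0.
have [u0 Bu0] : B !=set0.
  apply/set0P/eqP => B0; apply: (DB _ Dx0); rewrite B0; exact: card_ge0.
pose F x (rec : forall y, lt y x -> U) :=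
  xget u0 (B `\` [set v | exists y (h : lt y x), D y /\ v = rec y h]).
pose f := Fix lt_wf (fun=> U) F.
have fE x : f x = xget u0 (B `\` (f @` [set y | D y /\ lt y x])).
  rewrite /f Fix_eq; last first.
    move=> y g h gh; congr xget; congr (_ `\` _); apply/seteqP.
    by split=> v [z [hz [Dz ->]]]; exists z, hz; rewrite gh.
  congr xget; congr (_ `\` _); apply/seteqP; split=> v /=.
    by case=> y [h [Dy ->]]; exists y.
  by case=> y [Dy h] <-; exists y, h.
(* The default of [xget] is never reached on [D]: if all of [B] had been picked before [x], it would
   be an image of the part of [D] before [x], against [DB]. *)
have fP x : D x -> (B `\` (f @` [set y | D y /\ lt y x])) (f x).
  move=> Dx; rewrite fE; apply: xgetPex; apply: contrapT => none.
  apply: (DB x Dx); apply: card_le_trans (card_image_le f _).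
  by apply: subset_card_le => v Bv; apply: contrapT => nv; apply: none; exists v.
apply: (card_le_inj (f := f)) => [x /fP[]//|x y Dx Dy fxy].
apply: contrapT => /lt_total[xy|yx].
  by have [_] := fP y Dy; apply; exists x.
by have [_] := fP x Dx; apply; exists y.
Qed.

Section WellOrder.
Variables (d : Order.disp_t) (lam : orderType d).
Hypothesis lam_wo : wochoice.well_order (fun x y : lam => (x <= y)%O).
Implicit Types (a b x y : lam).

Lemma wo_min (P : set lam) : P !=set0 ->
  exists2 m, P m & forall x, P x -> (m <= x)%O.
Proof.
case=> x Px; have := lam_wo (A := [pred x | `[< P x >]]).
case; first by exists x; apply/asboolP.
move=> m [[/asboolP Pm mP] _]; exists m => // y Py.
by apply: mP; apply/asboolP.
Qed.

Lemma wo_wf : well_founded (fun x y : lam => (x < y)%O).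
Proof.
move=> x; apply: contrapT => nx.
have [m nm mP] := wo_min (P := [set y | ~ Acc (fun x y : lam => (x < y)%O) y])
  (ex_intro _ x nx).
apply: nm; constructor => y ym; apply: contrapT => /mP.
by rewrite leNgt ym.
Qed.

Lemma belowS a b : (a <= b)%O -> below a `<=` below b.
Proof. by move=> ab x /= xa; exact: lt_le_trans xa ab. Qed.

(** If [B] injects into no initial segment, greedy picking along [lam] never exhausts it. *)
Lemma card_le_below_or (U : choiceType) (B : set U) :
  (exists a, B #<= below a) \/ [set: lam] #<= B.
Proof.
have [|nB] := pselect (exists a, B #<= below a); [by left|right].
apply: (transfinite_card_le wo_wf).
  by move=> x y /eqP; rewrite neq_lt => /orP.
move=> x _ Bx; apply: nB; exists x; apply: card_le_trans Bx _.
by apply: subset_card_le => y [].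
Qed.

(* Goedel's ordering of pairs: a proper initial segment is contained in the    *)
(* square of an initial segment of lam.                                        *)
Definition pair_lt (p q : lam * lam) : Prop :=
  (Order.max p.1 p.2 < Order.max q.1 q.2)%O \/
  Order.max p.1 p.2 = Order.max q.1 q.2 /\
  ((p.1 < q.1)%O \/ p.1 = q.1 /\ (p.2 < q.2)%O).

Lemma pair_lt_wf : well_founded pair_lt.
Proof.
suff acc m : forall x y, Order.max x y = m -> Acc pair_lt (x, y).
  by case=> x y; exact: acc.
elim/(well_founded_ind wo_wf): m => m IHm.
elim/(well_founded_ind wo_wf) => x IHx.
elim/(well_founded_ind wo_wf) => y IHy xy.
constructor => -[x' y'] [/=|/= [e [lx|[ex ly]]]].
- by rewrite xy => h; exact: IHm h _ _ (erefl _).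
- by apply: IHx => //; rewrite e.
- by rewrite ex; apply: IHy => //; rewrite -ex e.
Qed.

Lemma pair_lt_total p q : p <> q -> pair_lt p q \/ pair_lt q p.
Proof.
case: p q => [x y] [x' y'] npq; rewrite /pair_lt /=.
have [?|?|e] := ltgtP (Order.max x y) (Order.max x' y'); [by left; left|by right; left|].
have [?|?|ex] := ltgtP x x'; [by left; right; split => //; left| |].
  by right; right; split => //; left.
have [?|?|ey] := ltgtP y y'; [by left; right; split => //; right| |].
  by right; right; split => //; right.
by case: npq; rewrite ex ey.
Qed.

(** Hessenberg's theorem. If [below a] injects into a smaller segment, the induction hypothesis
    applies there. Otherwise a proper initial segment of the pairs lies in the square of some
    [below m] with one point added, [m] below [a]; by induction this square is finite or no larger
    than [below m], so [below a] does not inject into it and greedy picking succeeds. *)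
Lemma card_below_sq a : infinite_set (below a) ->
  below a `*` below a #<= below a.
Proof.
elim/(well_founded_ind wo_wf): a => a IH a_inf.
have [[b [ba ab]]|acard] := pselect (exists b, (b < a)%O /\ below a #<= below b).
  have b_inf : infinite_set (below b).
    by move=> /(card_le_finite ab).
  apply: card_le_trans (card_le_setX ab ab) _.
  apply: card_le_trans (IH _ ba b_inf) _.
  by apply: subset_card_le; apply: belowS; exact: ltW.
apply: (transfinite_card_le pair_lt_wf pair_lt_total).
move=> [x y] [/= xa ya] seg.
pose m := Order.max x y; have ma : (m < a)%O by rewrite gt_max xa.
have {}seg : below a #<= (below m `|` [set m]) `*` (below m `|` [set m]).
  apply: card_le_trans seg _; apply: subset_card_le => -[z t] /= [_ zt].
  have : (Order.max z t <= m)%O by case: zt => [/ltW//|[-> _]].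
  have bm u : (u <= m)%O -> (below m `|` [set m]) u.
    by rewrite le_eqVlt => /orP[/eqP ->|?]; [right|left].
  by rewrite ge_max => /andP[/bm ? /bm].
have [m_fin|m_inf] := pselect (finite_set (below m)).
  apply: a_inf; apply: card_le_finite seg _.
  by apply: finite_setX; rewrite finite_setU; split=> //; exact: finite_set1.
have le_m := infinite_setU1_le m m_inf.
apply: acard; exists m; split=> //; apply: card_le_trans seg _.
exact: card_le_trans (card_le_setX le_m le_m) (IH _ ma m_inf).
Qed.
End WellOrder.

(** * Cardinal arithmetic below a singular cardinal *)

Section Singular.
Variables (d : Order.disp_t) (lam : orderType d).
Hypothesis hlam : singular_cardinal lam.
Implicit Types (a b k m x y : lam).

Lemma lam_wo : wochoice.well_order (fun x y : lam => (x <= y)%O).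
Proof. by case: hlam. Qed.

(** As lambda is a cardinal, this means having cardinality less than lambda. *)
Definition small (T : Type) (A : set T) : Prop := exists a : lam, A #<= below a.

Lemma lam_inhabited : exists x : lam, True.
Proof.
by case: hlam => _ _ /infinite_setN0[x _] _; exists x.
Qed.

Lemma lam_not_small : ~ small [set: lam].
Proof.
case=> a aT; case: hlam => _ /(_ a) + _ _; apply.
by rewrite card_eq_le aT andbT; apply: subset_card_le.
Qed.

Lemma lam_nomax x : exists y, (x < y)%O.
Proof.
apply: contrapT => xmax; apply: lam_not_small.
have lamE : [set: lam] `<=` below x `|` [set x].
  move=> y _; have [yx|xy|->] := ltgtP y x; [by left| |by right].
  by case: xmax; exists y.
exists x; apply: card_le_trans (subset_card_le lamE) _.
apply: infinite_setU1_le => x_fin; case: hlam => _ _ + _; apply.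
by apply: sub_finite_set lamE _; rewrite finite_setU; split.
Qed.

(** Comparability turns the failure of lambda to inject into [C] into smallness of [C]. *)
Lemma singular_cofinal : exists C : set lam,
  small C /\ forall x, exists2 c, C c & (x < c)%O.
Proof.
case: (hlam) => _ _ _ [C Ccof CT]; exists C; split.
  by have [|/CT] := card_le_below_or lam_wo C.
move=> x; have [y xy] := lam_nomax x; have [c Cc yc] := Ccof y.
by exists c => //; exact: lt_le_trans yc.
Qed.

(** This excludes lambda = omega: with finite segments only, a small cofinal set would be finite,
    and lambda a finite union of finite sets. *)
Lemma infinite_below : exists a, infinite_set (below a).
Proof.
apply: contrapT => fin_below.
have fin_b a : finite_set (below a).
  by apply: contrapT => ainf; apply: fin_below; exists a.
have [C [[a Ca] Ccof]] := singular_cofinal.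
case: hlam => _ _ + _; apply.
apply: (@sub_finite_set _ _ (\bigcup_(c in C) below c)).
  by move=> x _; have [c Cc xc] := Ccof x; exists c.
by apply: bigcup_finite => //; exact: card_le_finite Ca (fin_b a).
Qed.

Lemma infinite_below_ge a : exists2 b, (a <= b)%O & infinite_set (below b).
Proof.
have [c cinf] := infinite_below.
have [ac|ca] := leP a c; first by exists c.
exists a => // /(sub_finite_set _); move/(_ (below c)) => fin_c.
by apply/cinf/fin_c/belowS/ltW.
Qed.

Lemma small_le (T U : Type) (A : set T) (B : set U) :
  A #<= B -> small B -> small A.
Proof. by move=> AB [a Ba]; exists a; exact: card_le_trans Ba. Qed.

Lemma small_setX (T U : Type) (A : set T) (B : set U) :
  small A -> small B -> small (A `*` B).
Proof.
move=> [a Aa] [b Bb].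
have [c c_ge c_inf] := infinite_below_ge (Order.max a b).
move: c_ge; rewrite ge_max => /andP[ac bc]; exists c.
apply: card_le_trans (card_below_sq lam_wo c_inf).
by apply: card_le_setX; [apply: card_le_trans Aa _|apply: card_le_trans Bb _];
  apply: subset_card_le; exact: belowS.
Qed.

Lemma countable_small (T : Type) (A : set T) : countable A -> small A.
Proof.
move=> cA; have [a /infiniteP ainf] := infinite_below; exists a.
exact: card_le_trans cA ainf.
Qed.

Lemma small_bigcup_countable (I T : Type) (D : set I) (F : I -> set T) :
  small D -> (forall i, D i -> countable (F i)) -> small (\bigcup_(i in D) F i).
Proof.
move=> Dsm Fc; have [D0|/set0P[i0 _]] := eqVneq D set0.
  by rewrite D0 bigcup_set0; apply: countable_small.
apply: (small_le (bigcup_card_le i0 0%N Fc)); apply: small_setX => //.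
exact: countable_small.
Qed.

(** A singular cardinal is a limit cardinal: otherwise lambda would be a union, over a small cofinal
    set, of sets no larger than [below k], hence small. *)
Lemma lam_limit k : exists a, ~ (below a #<= below k).
Proof.
apply: contrapT => nk; have le_k a : below a #<= below k.
  by apply: contrapT => ak; apply: nk; exists a.
apply: lam_not_small; have [C [Csm Ccof]] := singular_cofinal.
apply: small_le (small_setX Csm (ex_intro _ k (card_lexx (below k)))).
have lamE : [set: lam] `<=` \bigcup_(c in C) below c.
  by move=> x _; have [c Cc xc] := Ccof x; exists c.
apply: card_le_trans (subset_card_le lamE) _.
by apply: bigcup_card_le.
Qed.

Lemma ex_successor_cardinal k : exists2 mu, is_successor_cardinal k mu &
  below k #<= below mu.
Proof.
have [mu nmu muP] := wo_min lam_wo (lam_limit k).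
have le_k a : (a < mu)%O -> below a #<= below k.
  by move=> amu; apply: contrapT => /muP; rewrite leNgt amu.
have kmu : (k < mu)%O.
  by rewrite ltNge; apply/negP => /belowS /subset_card_le.
exists mu; last by apply/subset_card_le/belowS/ltW.
split=> //.
  move=> a /le_k ak; rewrite card_eq_le => /andP[_ mua]; apply: nmu.
  exact: card_le_trans ak.
move=> a acard ka; rewrite leNgt; apply/negP => /le_k ak; apply: (acard k ka).
by rewrite card_eq_le ak andbT; apply/subset_card_le/belowS/ltW.
Qed.

Lemma ex_cardinal a : exists2 k : lam, is_cardinal k & below a #<= below k.
Proof.
have [k ak kP] := wo_min lam_wo (P := [set k : lam | below a #<= below k])
  (ex_intro _ a (card_lexx _)).
exists k => // b bk; rewrite card_eq_le => /andP[_ kb].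
by have := kP b (card_le_trans ak kb); rewrite leNgt bk.
Qed.

End Singular.

(** * Singular compactness *)

Lemma countable_setU (T : Type) (A B : set T) :
  countable A -> countable B -> countable (A `|` B).
Proof.
move=> cA cB; rewrite -bigcup2E; apply: bigcup_countable => // -[|[|n]] _ //=.
Qed.

Section Covers.
Variables (T : Type) (approx : T -> set T -> Prop).
Implicit Types (E : T -> set T) (s t : T) (u G : set T).

Definition closed_under E G : Prop := forall s t, G s -> E s t -> G t.

Definition symmetric_countable E : Prop :=
  (forall s t, E s t -> E t s) /\ forall s, countable (E s).

(** [G] is a closed subset of the whole type and may leave [u]; only its points in [u] have to be
    approximable in it. *)
Definition covers E u : Prop :=
  symmetric_countable E /\
  forall s G, u s -> G s -> closed_under E G -> approx s G.
End Covers.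

Section Compactness.
Variables (d : Order.disp_t) (lam : orderType d).
Hypothesis hlam : singular_cardinal lam.
Variable approx : lam -> set lam -> Prop.
Hypothesis approxS : forall s (G H : set lam), G `<=` H -> approx s G -> approx s H.
Implicit Types (E : lam -> set lam) (s t : lam) (u G : set lam).

(* For i in a short cofinal set C, the set Aw i contains all points below i, is *)
(* covered by Ew i, and is closed under Ew j for every j in C. Hence Ew i can   *)
(* be cut down to the points whose first index r s is i, and the union over i   *)
(* of these restrictions covers everything.                                     *)
Theorem singular_compactness :
  (forall u, small lam u -> exists E, covers approx E u) -> exists E, covers approx E setT.
Proof.
move=> small_covered.
have [x0 _] := lam_inhabited hlam.
have /choice[w wP] : forall u, exists E, small lam u -> covers approx E u.
  move=> u; have [/small_covered[E EP]|nu] := pselect (small lam u).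
    by exists E.
  by exists (fun=> set0).
have [C [Csm Ccof]] := singular_cofinal hlam.
(* One round adds to the set of [i] the neighbours of its points under the relations of all indices
   in [C], the singleton keeping the old points. The new set is still small, so the relation of [i]
   can then be enlarged by a cover of it. *)
pose step (AE : (lam -> set lam) * (lam -> lam -> set lam)) :=
  let A' i := \bigcup_(p in C `*` AE.1 i) ([set p.2] `|` AE.2 p.1 p.2) in
  (A', fun i s => AE.2 i s `|` w (A' i) s).
pose AE n := iter n step (@below d lam, fun i => w (below i)).
pose A n := (AE n).1; pose E n := (AE n).2.
have AS n i : A n.+1 i = \bigcup_(p in C `*` A n i) ([set p.2] `|` E n p.1 p.2) by [].
have ES n i s : E n.+1 i s = E n i s `|` w (A n.+1 i) s by [].
have smE n : (forall i, small lam (A n i)) /\ forall i, symmetric_countable (E n i).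
  elim: n => [|n [IHA IHE]].
    have sm0 i : small lam (A 0%N i) by exists i; exact: card_lexx.
    by split=> // i; have [] := wP _ (sm0 i).
  have smS i : small lam (A n.+1 i).
    rewrite AS; apply: (small_bigcup_countable hlam).
      exact: small_setX.
    move=> p _; have [_ /(_ p.2)] := IHE p.1.
    by move=> cE; apply: countable_setU => //; exact: countable1.
  split=> // i; have [[wsym wc] _] := wP _ (smS i); have [Esym Ec] := IHE i.
  split=> [s t|s]; rewrite !ES.
    by case=> [/Esym|/wsym]; [left|right].
  exact: countable_setU.
have AmonoS n i : A n i `<=` A n.+1 i.
  move=> s As; have [c Cc _] := Ccof x0; rewrite AS.
  by exists (c, s) => //; left.
have Amono i m n : (m <= n)%N -> A m i `<=` A n i.
  elim: n => [|n IHn]; first by rewrite leqn0 => /eqP ->.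
  rewrite leq_eqVlt => /orP[/eqP -> //|]; rewrite ltnS => /IHn mn.
  exact: subset_trans (AmonoS n i).
have Emono i s m n : (m <= n)%N -> E m i s `<=` E n i s.
  elim: n => [|n IHn]; first by rewrite leqn0 => /eqP ->.
  rewrite leq_eqVlt => /orP[/eqP -> //|]; rewrite ltnS => /IHn mn.
  by apply: subset_trans mn _; rewrite ES; left.
pose Aw i := \bigcup_n A n i; pose Ew i s := \bigcup_n E n i s.
have Ewsym i : symmetric_countable (Ew i).
  split=> [s t [n _]|s].
    by have [_ /(_ i)[Esym _] /Esym] := smE n; exists n.
  apply: bigcup_countable => // n _.
  by have [_ /(_ i)[_]] := smE n.
have sat i j : C i -> closed_under (Ew i) (Aw j).
  move=> Ci s t [m _ As] [n _ Et]; exists (maxn m n).+1 => //; rewrite AS.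
  exists (i, s); first by split=> //=; apply: Amono As; exact: leq_maxl.
  by right; apply: Emono Et; exact: leq_maxr.
(* [Ew i] includes the cover chosen for the stage after [s] has entered, so [G] is closed under that
   cover. *)
have good i s G : Aw i s -> G s -> closed_under (Ew i) G -> approx s G.
  move=> [n _ As] Gs Gcl; have [smA _] := smE n.+1.
  have [_] := wP _ (smA i); apply => //; first exact: AmonoS.
  by move=> x y Gx wxy; apply: Gcl Gx _; exists n.+1 => //; right.
have /choice[r rP] : forall s, exists i, [/\ C i, Aw i s &
    forall j, C j -> Aw j s -> (i <= j)%O].
  move=> s; have [c Cc sc] := Ccof s.
  have [|i [Ci Ai] iP] := wo_min (lam_wo hlam) (P := [set i | C i /\ Aw i s]).
    by exists c; split=> //; exists 0%N.
  by exists i; split=> // j Cj Aj; exact: iP.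
exists (fun s => [set t | r s = r t /\ Ew (r s) s t]); split.
  split=> [s t [rst Est]|s].
    by split=> //; rewrite -rst; apply: (proj1 (Ewsym _)).
  apply: sub_countable (proj2 (Ewsym (r s)) s).
  by apply: subset_card_le => t [].
move=> s G _ Gs Gcl; have [Crs Ars _] := rP s.
(* By monotonicity it suffices to use the points of [G] with the first index of [s]. They are closed
   under [Ew (r s)]: every [Aw j] is closed under this symmetric relation, so related points lie in
   the same sets [Aw j] and share their first index. *)
apply: (approxS (G := [set t | G t /\ r t = r s])) => [t []//|].
apply: (good (r s)) => // t y [Gt rt] Ety.
have [_ At tmin] := rP t; have [Cy Ay ymin] := rP y.
have ry : r y = r s.
  apply/eqP; rewrite eq_le; apply/andP; split.
    by apply: ymin => //; apply: (sat (r s)) Ety => //; rewrite -rt.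
  rewrite -rt; apply: tmin => //; apply: (sat (r s)) Ay _ => //.
  exact: (proj1 (Ewsym _)).
by split=> //; apply: (Gcl t) => //; rewrite /= rt ry.
Qed.

End Compactness.

Local Open Scope ring_scope.

(** * The space of square-summable functions *)

(* The polarization law reduces the convergence of inner products to that of   *)
(* sums of squared norms, without separate treatment of real and imaginary     *)
(* parts.                                                                      *)
Record scalar_laws (R : realType) (K : numFieldType) (conj : K -> K)
    (iota : {rmorphism R -> K}) : Prop := ScalarLaws {
  iota_le : forall a b, (iota a <= iota b) = (a <= b);
  iota_onto : forall x, 0 <= x -> exists r, x = iota r;
  conjD : forall x y, conj (x + y) = conj x + conj y;
  conjM : forall x y, conj (x * y) = conj x * conj y;
  conjK : forall x, conj (conj x) = x;
  mul_conj : forall x, x * conj x = `|x| ^+ 2;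
  polarization : exists n (c a : 'I_n -> K), forall x y,
    x * conj y = \sum_(k < n) c k * `|x + a k * y| ^+ 2 }.

Section RealOrComplex.
Local Open Scope complex_scope.

Lemma sqr_norm_complex (R : rcfType) (a b : R) :
  `|a +i* b| ^+ 2 = (a ^+ 2 + b ^+ 2)%:C :> R[i].
Proof.
rewrite normc_def /= -rmorphXn /= sqr_sqrtr //.
by rewrite addr_ge0 // sqr_ge0.
Qed.

(** Polarization uses the roots of unity of order two over the reals and four over the complex
    numbers, each weighted by a quarter of itself. *)
Lemma real_or_complex_laws (R : realType) (K : numFieldType) (conj : K -> K) :
  real_or_complex R conj -> exists iota : {rmorphism R -> K}, scalar_laws conj iota.
Proof.
case.
  exists idfun; split=> //; first by move=> x; exists x.
    by move=> x; rewrite real_normK ?num_real.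
  exists 2%N, (fun k => (-1) ^+ k / 4%:R), (fun k => (-1) ^+ k) => x y.
  rewrite !big_ord_recl big_ord0 /= !real_normK ?num_real //.
  by rewrite /bump /= expr0 expr1; field.
exists (@real_complex R); split.
- by move=> a b; rewrite lecR.
- move=> [a b]; rewrite lecE /= => /andP[/eqP -> _]; by exists a.
- exact: rmorphD.
- exact: rmorphM.
- exact: conjcK.
- move=> [a b]; rewrite sqr_norm_complex; apply/eqP; rewrite eq_complex /=.
  by apply/andP; split; apply/eqP; ring.
pose a : seq R[i] := [:: 1; 'i; -1; -'i].
exists 4%N, (fun k => (4%:R^-1)%:C * a`_k), (fun k => a`_k) => -[x1 x2] [y1 y2].
rewrite !big_ord_recl big_ord0 /= /a /bump /=.
have ca (u v p q : R) : (u +i* v) + (p +i* q) = (u + p) +i* (v + q) by [].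
have cm (u v p q : R) : (u +i* v) * (p +i* q) = (u * p - v * q) +i* (u * q + v * p) by [].
have e1 : 1 = 1 +i* 0 :> R[i] by [].
have en : -1 = (-1) +i* (-0) :> R[i] by [].
have ein : - 'i = (-0) +i* (-1) :> R[i] by [].
have nrm (p q : R) : `|x1 +i* x2 + (p +i* q) * (y1 +i* y2)| ^+ 2 =
    ((x1 + (p * y1 - q * y2)) ^+ 2 + (x2 + (p * y2 + q * y1)) ^+ 2)%:C :> R[i].
  by rewrite cm ca sqr_norm_complex.
rewrite en ein e1 !nrm /real_complex_def !cm.
have -> : 0 = 0 +i* 0 :> R[i] by [].
rewrite !ca.
by apply/eqP; rewrite eq_complex /=; apply/andP; split; apply/eqP; field.
Qed.
End RealOrComplex.

Lemma iota_lt (R : realType) (K : numFieldType) (conj : K -> K)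
    (iota : {rmorphism R -> K}) : scalar_laws conj iota ->
  forall a b, (iota a < iota b) = (a < b).
Proof.
by move=> laws a b; rewrite !lt_neqAle (iota_le laws) (inj_eq (fmorph_inj iota)).
Qed.

Lemma iota_gt0 (R : realType) (K : numFieldType) (conj : K -> K)
    (iota : {rmorphism R -> K}) : scalar_laws conj iota ->
  forall a, (0 < iota a) = (0 < a).
Proof. by move=> laws a; rewrite -(iota_lt laws) rmorph0. Qed.

Section Sums.
Variables (R : realType) (K : numFieldType) (conj : K -> K).
Variables (iota : {rmorphism R -> K}) (laws : scalar_laws conj iota).
Variable S : choiceType.
Implicit Types (f g : S -> K) (J : {fset S}).

Lemma conj0 : conj 0 = 0.
Proof. by apply: (addrI (conj 0)); rewrite -(conjD laws) !addr0. Qed.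

Lemma conjN x : conj (- x) = - conj x.
Proof. by apply: (addrI (conj x)); rewrite -(conjD laws) !subrr conj0. Qed.

Lemma norm_conj x : `|conj x| = `|x|.
Proof.
apply/eqP; rewrite -(eqrXn2 (n := 2)) //; apply/eqP.
by rewrite -!(mul_conj laws) (conjK laws) mulrC.
Qed.

Lemma partial_sumE f J : partial_sum f J = \sum_(x <- J) f x.
Proof. by rewrite /partial_sum big_seq_fsetE. Qed.

Lemma partial_sumD f g J :
  partial_sum (fun x => f x + g x) J = partial_sum f J + partial_sum g J.
Proof. exact: big_split. Qed.

Lemma partial_sumZ a f J : partial_sum (fun x => a * f x) J = a * partial_sum f J.
Proof. by rewrite /partial_sum mulr_sumr. Qed.

Lemma ler_partial_sum f g J : (forall x, f x <= g x) ->
  partial_sum f J <= partial_sum g J.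
Proof. by move=> fg; apply: ler_sum. Qed.

Lemma partial_sum_incl f J J' : (J `<=` J')%fset ->
  partial_sum f J = partial_sum (fun x => if x \in J then f x else 0) J'.
Proof.
move=> JJ'; rewrite !partial_sumE.
transitivity (\sum_(x <- J) (if x \in J then f x else 0)).
  by apply: eq_big_seq => x ->.
by apply: big_fset_incl => // x _ /negbTE ->.
Qed.

Lemma partial_sum_mono f J J' : (forall x, 0 <= f x) -> (J `<=` J')%fset ->
  partial_sum f J <= partial_sum f J'.
Proof.
move=> f0 /partial_sum_incl ->; apply: ler_partial_sum => x.
by case: ifP.
Qed.

Definition has_sum f (l : K) : Prop := partial_sum f @ totally --> l.

Lemma has_sum_sum f l : has_sum f l -> sum f = l.
Proof. exact: (cvg_lim (@norm_hausdorff K K^o)). Qed.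

Lemma has_sum_ext f g l : f =1 g -> has_sum f l -> has_sum g l.
Proof. by move=> /funext ->. Qed.

Lemma has_sumD f g l m : has_sum f l -> has_sum g m ->
  has_sum (fun x => f x + g x) (l + m).
Proof.
rewrite /has_sum => fl gm.
rewrite (_ : partial_sum _ = (fun J => partial_sum f J + partial_sum g J)).
  exact: (@cvgD K K^o).
by apply/funext => J; exact: partial_sumD.
Qed.

Lemma has_sumZ a f l : has_sum f l -> has_sum (fun x => a * f x) (a * l).
Proof.
rewrite /has_sum => fl.
rewrite (_ : partial_sum _ = (fun J => a * partial_sum f J)); last first.
  by apply/funext => J; exact: partial_sumZ.
exact: cvgMl_tmp.
Qed.

Lemma has_sum_conj f l : has_sum f l -> has_sum (fun x => conj (f x)) (conj l).
Proof.
move=> fl; apply/cvgrPdist_lt => e e0.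
have /cvgrPdist_lt /(_ e e0) := fl.
apply: filterS => J; rewrite -norm_conj (conjD laws) conjN.
congr (`|_ - _| < _); rewrite /partial_sum.
by apply: (big_morph conj (conjD laws) conj0).
Qed.

(** The limit is the supremum of the partial sums, taken in [R] through [iota] because suprema are
    at hand there and not in [K]. *)
Lemma nonneg_has_sum f : (forall x, 0 <= f x) ->
  (exists M, forall J, partial_sum f J <= M) -> exists l, [/\ has_sum f l,
    forall J, partial_sum f J <= l &
    forall M, (forall J, partial_sum f J <= M) -> l <= M].
Proof.
move=> f0 [M fM].
have ps0 J : 0 <= partial_sum f J by apply: sumr_ge0.
have /choice[g gP] J : exists r, partial_sum f J = iota r.
  by apply: (iota_onto laws).
have [m mE] : exists m, M = iota m.
  by apply: (iota_onto laws); apply: le_trans (ps0 fset0) (fM _).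
have gsup : has_sup (range g).
  split; first by exists (g fset0); exists fset0.
  exists m => _ [J _ <-]; by rewrite -(iota_le laws) -gP -mE.
have ub J : partial_sum f J <= iota (sup (range g)).
  by rewrite gP (iota_le laws); apply: ub_le_sup; [exact: gsup.2|exists J].
exists (iota (sup (range g))); split=> //.
  apply/cvgrPdist_lt => e e0.
  have [r re] := iota_onto laws (ltW e0).
  have r0 : 0 < r by rewrite -(iota_gt0 laws) -re.
  have [_ [J0 _ <-] hJ0] := sup_adherent r0 gsup.
  exists J0 => // J /= J0J.
  rewrite ger0_norm ?subr_ge0 // ltrBlDr -ltrBlDl.
  apply: lt_le_trans (partial_sum_mono f0 J0J).
  by rewrite gP re -rmorphB (iota_lt laws).
move=> N fN; have [n nE] : exists n, N = iota n.
  by apply: (iota_onto laws); apply: le_trans (ps0 fset0) (fN _).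
rewrite nE (iota_le laws); apply: sup_le_ub; first by exists (g fset0); exists fset0.
by move=> _ [J _ <-]; rewrite -(iota_le laws) -gP -nE.
Qed.

End Sums.

(** A crude triangle inequality for squares: it spares Cauchy-Schwarz, and the factor 2 is absorbed
    by halving errors once more. *)
Lemma sqr_normD_le (K : numFieldType) (x y : K) :
  `|x + y| ^+ 2 <= 2 * (`|x| ^+ 2 + `|y| ^+ 2).
Proof.
apply: (@le_trans _ _ ((`|x| + `|y|) ^+ 2)).
  by rewrite lerXn2r ?nnegrE ?addr_ge0 ?ler_normD.
rewrite -subr_ge0; have -> : 2 * (`|x| ^+ 2 + `|y| ^+ 2) - (`|x| + `|y|) ^+ 2 =
  (`|x| - `|y|) ^+ 2 by ring.
by rewrite real_exprn_even_ge0 // rpredB.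
Qed.

Definition linear_subset (K : numFieldType) (V : lmodType K) (Y : set V) : Prop :=
  Y 0 /\ forall a u v, Y u -> Y v -> Y (a *: u + v).

Section LinearSubset.
Variables (K : numFieldType) (V : lmodType K) (Y : set V).
Hypothesis Ylin : linear_subset Y.

Lemma linear_subsetD u v : Y u -> Y v -> Y (u + v).
Proof. by rewrite -{2}[u]scale1r; apply: (proj2 Ylin). Qed.

Lemma linear_subsetZ a u : Y u -> Y (a *: u).
Proof. by move=> Yu; rewrite -[_ *: _]addr0; apply: (proj2 Ylin) => //; case: Ylin. Qed.

Lemma linear_subsetB u v : Y u -> Y v -> Y (u - v).
Proof. by move=> Yu Yv; rewrite addrC -scaleN1r; apply: (proj2 Ylin). Qed.

Lemma linear_subset_sum (I : Type) (r : seq I) (P : pred I) (F : I -> V) :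
  (forall i, P i -> Y (F i)) -> Y (\sum_(i <- r | P i) F i).
Proof.
move=> YF; apply: (big_ind Y) => //; [by case: Ylin|exact: linear_subsetD].
Qed.

Lemma linear_span_min (B : set V) : B `<=` Y -> linear_span B `<=` Y.
Proof.
move=> BY _ [n [a [b [Bb ->]]]]; apply: linear_subset_sum => i _.
by apply: linear_subsetZ; exact: BY.
Qed.
End LinearSubset.

Section LinearSpan.
Variables (K : numFieldType) (V : lmodType K).
Implicit Types B : set V.

Lemma sub_linear_span B : B `<=` linear_span B.
Proof.
move=> b Bb; exists 1%N, (fun=> 1), (fun=> b); split=> //.
by rewrite big_ord_recl big_ord0 addr0 scale1r.
Qed.

Lemma linear_span_linear B : linear_subset (linear_span B).
Proof.
split; first by exists 0%N, (fun=> 0), (fun=> 0); split; [case|rewrite big_ord0].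
move=> c _ _ [n [a [b [Bb ->]]]] [m [a' [b' [Bb' ->]]]].
exists (n + m)%N, (fun i : 'I_(n + m) => match fintype.split i with inl j => c * a j | inr j => a' j end),
  (fun i : 'I_(n + m) => match fintype.split i with inl j => b j | inr j => b' j end).
split; first by move=> i; case: fintype.split.
rewrite big_split_ord scaler_sumr; congr (_ + _); apply: eq_bigr => i _.
  by rewrite (unsplitK (inl i)) scalerA.
by rewrite (unsplitK (inr i)).
Qed.

Lemma linear_spanS B B' : B `<=` B' -> linear_span B `<=` linear_span B'.
Proof.
move=> BB'; apply: linear_span_min; first exact: linear_span_linear.
by apply: subset_trans BB' _; exact: sub_linear_span.
Qed.
End LinearSpan.

Section Ell2Space.
Variables (R : realType) (K : numFieldType) (conj : K -> K).
Variables (iota : {rmorphism R -> K}) (laws : scalar_laws conj iota).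
Variable S : choiceType.
Implicit Types (u v w : S -> K) (J : {fset S}) (Y : set (S -> K)).

Local Notation ell2 := (ell2 K S).
Local Notation ip := (ell2_ip conj S).
Local Notation N u := (ip u u).
Let sq u := fun x => `|u x| ^+ 2.

Lemma sq_ge0 u x : 0 <= sq u x.
Proof. exact: exprn_ge0. Qed.

Lemma ell2_linear : linear_subset ell2.
Proof.
split.
  exists 0 => J; rewrite /partial_sum big1 // => i _.
  by rewrite normr0 expr0n.
move=> a u v [M uM] [M' vM']; exists (2 * (`|a| ^+ 2 * M + M')) => J.
apply: (@le_trans _ _ (partial_sum (fun x => 2 * (`|a| ^+ 2 * sq u x + sq v x)) J)).
  apply: ler_partial_sum => x; apply: le_trans (sqr_normD_le _ _) _.
  by rewrite ler_wpM2l // lerD2r normrM exprMn.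
rewrite partial_sumZ partial_sumD partial_sumZ ler_wpM2l // lerD //.
by rewrite ler_wpM2l // exprn_ge0.
Qed.

Lemma ell2_norm u : ell2 u -> [/\ has_sum (sq u) (N u),
  forall J, partial_sum (sq u) J <= N u &
  forall M, (forall J, partial_sum (sq u) J <= M) -> N u <= M].
Proof.
move=> /(nonneg_has_sum laws (sq_ge0 u))[l [ul ub lub]].
suff -> : N u = l by [].
by apply: has_sum_sum; apply: has_sum_ext _ ul => x; rewrite (mul_conj laws).
Qed.

Lemma ell2_norm_ub u : ell2 u -> forall J, partial_sum (sq u) J <= N u.
Proof. by case/ell2_norm. Qed.

Lemma ell2_norm_lub u M : ell2 u ->
  (forall J, partial_sum (sq u) J <= M) -> N u <= M.
Proof. by case/ell2_norm => _ _; apply. Qed.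

Lemma ell2_norm_point u x : ell2 u -> `|u x| ^+ 2 <= N u.
Proof.
move=> /ell2_norm_ub /(_ [fset x]%fset).
by rewrite partial_sumE big_seq_fset1.
Qed.

Lemma ell2_norm_ge0 u : ell2 u -> 0 <= N u.
Proof.
move=> /ell2_norm_ub /(_ fset0); apply: le_trans.
by apply: sumr_ge0 => x _; exact: sq_ge0.
Qed.

Lemma ell2_norm_eq0 u : ell2 u -> N u = 0 -> u = 0.
Proof.
move=> lu Nu0; apply/funext => x; have := ell2_norm_point x lu.
rewrite Nu0 => ux0; apply/eqP; rewrite -normr_eq0 -sqrf_eq0.
by rewrite eq_le ux0 exprn_ge0.
Qed.

Lemma ell2_ip_has_sum u v : ell2 u -> ell2 v ->
  has_sum (fun x => u x * conj (v x)) (ip u v).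
Proof.
move=> lu lv; have [n [c [a pol]]] := polarization laws.
suff [l ul] : exists l, has_sum (fun x => u x * conj (v x)) l.
  by rewrite /ell2_ip (has_sum_sum ul).
suff [l ul] : exists l, has_sum
    (fun x => \sum_(k < n) c k * `|u x + a k * v x| ^+ 2) l.
  by exists l; apply: has_sum_ext _ ul => x; rewrite pol.
elim: n c a {pol} => [|n IHn] c a.
  exists 0; rewrite /has_sum; under eq_fun do rewrite big_ord0.
  rewrite (_ : partial_sum _ = fun=> 0); first exact: cvg_cst.
  by apply/funext => J; rewrite /partial_sum big1.
have [l ul] := IHn (fun k => c (lift ord0 k)) (fun k => a (lift ord0 k)).
have law : ell2 (a ord0 *: v + u) by apply: (proj2 ell2_linear).
have [us _ _] := ell2_norm law.
exists (c ord0 * N (a ord0 *: v + u) + l).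
have h := has_sumD (has_sumZ (a := c ord0) us) ul; apply: (has_sum_ext _ h) => x.
by rewrite big_ord_recl /sq [u x + _]addrC.
Qed.

Lemma ell2_ip_lin a u v w : ell2 u -> ell2 v -> ell2 w ->
  ip (a *: u + v) w = a * ip u w + ip v w.
Proof.
move=> lu lv lw; apply: has_sum_sum.
apply: has_sum_ext _ (has_sumD (has_sumZ (a := a) (ell2_ip_has_sum lu lw))
  (ell2_ip_has_sum lv lw)) => x.
by rewrite mulrA -mulrDl.
Qed.

Lemma ell2_ip_conj u v : ell2 u -> ell2 v -> ip v u = conj (ip u v).
Proof.
move=> lu lv; apply: has_sum_sum.
apply: has_sum_ext _ (has_sum_conj laws (ell2_ip_has_sum lu lv)) => x.
by rewrite (conjM laws) (conjK laws) mulrC.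
Qed.

Lemma ell2_ip_disjoint u v : (forall x, u x = 0 \/ v x = 0) -> ip u v = 0.
Proof.
move=> uv0; apply: has_sum_sum; rewrite /has_sum.
rewrite (_ : partial_sum _ = fun=> 0); first exact: cvg_cst.
apply/funext => J; rewrite /partial_sum big1 // => i _.
by have [->|->] := uv0 (val i); rewrite ?mul0r // (conj0 laws) mulr0.
Qed.

Lemma ell2_norm_lin a u v : ell2 u -> ell2 v ->
  N (a *: u + v) <= 2 * (`|a| ^+ 2 * N u + N v).
Proof.
move=> lu lv; apply: ell2_norm_lub; first exact: (proj2 ell2_linear).
move=> J.
apply: (@le_trans _ _ (partial_sum (fun x => 2 * (`|a| ^+ 2 * sq u x + sq v x)) J)).
  apply: ler_partial_sum => x; apply: le_trans (sqr_normD_le _ _) _.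
  by rewrite ler_wpM2l // lerD2r normrM exprMn.
rewrite partial_sumZ partial_sumD partial_sumZ ler_wpM2l // lerD //.
  by rewrite ler_wpM2l ?exprn_ge0 // ell2_norm_ub.
exact: ell2_norm_ub.
Qed.

Lemma ell2_le u v : (forall x, `|v x| <= `|u x|) -> ell2 u -> ell2 v.
Proof.
move=> vu [M uM]; exists M => J; apply: le_trans (uM J).
by apply: ler_partial_sum => x; rewrite lerXn2r ?nnegrE.
Qed.

Lemma ell2_norm_le u v : (forall x, `|v x| <= `|u x|) -> ell2 u -> N v <= N u.
Proof.
move=> vu lu; apply: ell2_norm_lub; first exact: ell2_le lu.
move=> J; apply: le_trans (ell2_norm_ub lu J).
by apply: ler_partial_sum => x; rewrite lerXn2r ?nnegrE.
Qed.

Definition unit_vector (s : S) : S -> K := fun x => (x == s)%:R.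

Lemma ell2_unit_vector s : ell2 (unit_vector s).
Proof.
exists 1 => J; rewrite partial_sumE.
apply: (@le_trans _ _ (\sum_(x <- J) (x == s)%:R)).
  by apply: ler_sum => x _; rewrite /unit_vector; case: eqP => _;
    rewrite ?normr1 ?normr0 ?expr1n ?expr0n.
have [sJ|sJ] := boolP (s \in J).
  by rewrite (big_fsetD1 s) //= eqxx big1_fset ?addr0 // => x;
    rewrite !inE => /andP[/negbTE ->].
rewrite big1_fset // => x xJ _; case: eqP => // xs.
by rewrite xs (negbTE sJ) in xJ.
Qed.

(** The part of [u] outside [J] has squared norm at most [N u] minus the partial sum over [J]: add
    the sums over [J] and [J'] inside their union. *)
Lemma ell2_truncation u e : ell2 u -> 0 < e -> exists J,
  N (u - \sum_(s <- J) u s *: unit_vector s) < e.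
Proof.
move=> lu e0; have [us uub _] := ell2_norm lu.
have /cvgrPdist_lt /(_ e e0) [J _ /(_ J (fsubset_refl J))] := us.
rewrite ger0_norm ?subr_ge0 // => NJ; exists J; apply: le_lt_trans NJ.
have truncE : u - \sum_(s <- J) u s *: unit_vector s =
    fun x => if x \in J then 0 else u x.
  apply/funext => x.
  transitivity (u x - \sum_(s <- J) u s * (x == s)%:R).
    by congr (_ - _); rewrite fct_sumE.
  have [xJ|xJ] := boolP (x \in J).
    rewrite (big_fsetD1 x) //= eqxx mulr1 big1_fset ?addr0 ?subrr // => y.
    by rewrite !inE eq_sym => /andP[/negbTE -> _] _; rewrite mulr0.
  rewrite big1_fset ?subr0 // => y yJ _; case: eqP => [xy|]; last by rewrite mulr0.
  by rewrite xy yJ in xJ.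
rewrite truncE; apply: ell2_norm_lub.
  by apply: ell2_le lu => x; case: ifP => _; rewrite ?normr0.
move=> J'; rewrite lerBrDl; apply: le_trans (uub (J `|` J')%fset).
rewrite (partial_sum_incl _ (fsubsetUl J J')).
set t := sq (fun x => if x \in J then 0 else u x).
apply: (@le_trans _ _ (partial_sum (fun x => if x \in J then sq u x else 0)
    (J `|` J')%fset + partial_sum t (J `|` J')%fset)).
  by rewrite lerD2l; apply: partial_sum_mono => [x|]; [exact: sq_ge0|exact: fsubsetUr].
rewrite -partial_sumD; apply: ler_partial_sum => x; rewrite /t /sq.
by case: ifP => _; rewrite ?normr0 ?expr0n ?addr0 ?add0r.
Qed.

End Ell2Space.

(** * Closures and orthonormal bases *)

(** For each [n], only finitely many points of [D] satisfy [n.+1%:R^-1 <= g x], since their sum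
    would otherwise exceed [m]. *)
Lemma countable_support_bounded_sums (R : realType) (T : choiceType) (D : set T)
    (g : T -> R) (m : R) :
  (forall x, 0 <= g x) ->
  (forall J : {fset T}, [set` J] `<=` D -> \sum_(x <- J) g x <= m) ->
  countable [set x | D x /\ g x != 0].
Proof.
move=> g0 gm; pose A n := [set x | D x /\ n.+1%:R^-1 <= g x].
have -> : [set x | D x /\ g x != 0] = \bigcup_n A n.
  apply/seteqP; split=> x.
    move=> [Dx gx]; have gx0 : 0 < g x by rewrite lt_neqAle eq_sym gx g0.
    exists (Num.bound (g x)^-1) => //; split=> //.
    rewrite -[leRHS]invrK lef_pV2 ?posrE ?invr_gt0 //.
    apply/ltW/(lt_le_trans (archi_boundP _)); first by rewrite invr_ge0.
    by rewrite ler_nat.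
  move=> [n _ [Dx gx]]; split=> //; rewrite gt_eqF //.
  by apply: lt_le_trans gx; rewrite invr_gt0.
apply: bigcup_countable => // n _; apply: finite_set_countable.
apply: contrapT => An_inf.
have m0 : 0 <= m by apply: le_trans (gm fset0 _); rewrite ?big_seq_fset0.
have [X XA Xn] := infinite_set_fset (Num.bound (m * n.+1%:R)) An_inf.
have := gm X (fun x xX => proj1 (XA x xX)); apply/negP; rewrite -ltNge.
apply: (@lt_le_trans _ _ (\sum_(x <- X) n.+1%:R^-1)); last first.
  by rewrite big_seq [leRHS]big_seq; apply: ler_sum => x /XA[].
rewrite big_const_seq count_predT iter_addr_0 -[ltRHS]mulr_natl ltr_pdivlMr //.
apply: lt_le_trans (archi_boundP _) _; first by rewrite mulr_ge0.
by rewrite ler_nat.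
Qed.

Section Geometry.
Variables (R : realType) (K : numFieldType) (conj : K -> K).
Variables (iota : {rmorphism R -> K}) (laws : scalar_laws conj iota).
Variable S : choiceType.
Implicit Types (u v w : S -> K) (J : {fset S -> K}) (X Y Z B : set (S -> K)).
Implicit Types (G : set S) (s t : S).

Local Notation ell2 := (ell2 K S).
Local Notation ip := (ell2_ip conj S).
Local Notation N u := (ip u u).
Local Notation e_ s := (unit_vector K s).

Lemma countable_nonzero (T : choiceType) (D : set T) (f : T -> K) (M : K) :
  (forall J : {fset T}, [set` J] `<=` D -> \sum_(x <- J) `|f x| ^+ 2 <= M) ->
  countable [set x | D x /\ f x != 0].
Proof.
move=> fM.
have /choice[g gP] x : exists r, `|f x| ^+ 2 = iota r.
  by apply: (iota_onto laws); rewrite exprn_ge0.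
have [m mE] : exists m, M = iota m.
  apply: (iota_onto laws); apply: le_trans (fM fset0 _); last by [].
  by rewrite big_seq_fset0.
apply: sub_countable (countable_support_bounded_sums (D := D) (g := g) (m := m) _ _).
- apply: subset_card_le => x [Dx fx]; split=> //.
  apply: contra_neq fx => gx; apply/eqP.
  by rewrite -normr_eq0 -sqrf_eq0 gP gx rmorph0.
- by move=> x; rewrite -(iota_le laws) rmorph0 -gP exprn_ge0.
move=> J JD; rewrite -(iota_le laws) -mE rmorph_sum /=.
by under eq_bigr do rewrite -gP; exact: fM.
Qed.

(** The closure within [ell2]. Comparing the squared norm with [e] itself keeps square roots out of
    the estimates, at the price of one in [dense_in_closure]. *)
Definition closure_of Y : set (S -> K) :=
  [set v | ell2 v /\ forall e, 0 < e -> exists2 w, Y w & N (v - w) < e].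

Lemma dense_in_closure Y Z : dense_in ip Y Z -> Z `<=` ell2 ->
  Z `<=` closure_of Y.
Proof.
move=> [_ YZ] Zl v Zv; split; first exact: Zl.
move=> e e0; have [r re] := iota_onto laws (ltW e0).
have r0 : 0 <= r by rewrite -(iota_le laws) rmorph0 -re ltW.
have re2 : iota (Num.sqrt r) ^+ 2 = e by rewrite -rmorphXn /= sqr_sqrtr.
have sr0 : 0 < iota (Num.sqrt r).
  by rewrite (iota_gt0 laws) sqrtr_gt0 -(iota_gt0 laws) -re.
by have [w Yw] := YZ v Zv _ sr0; rewrite re2; exists w.
Qed.

Lemma closure_dense_in Y Z : Y `<=` Z -> Z `<=` closure_of Y -> dense_in ip Y Z.
Proof.
by move=> YZ Zcl; split=> // v /Zcl[_ vY] e e0; apply: vY; rewrite exprn_gt0.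
Qed.

Lemma closure_ofS Y Z : Y `<=` Z -> closure_of Y `<=` closure_of Z.
Proof.
move=> YZ v [lv vY]; split=> // e /vY[w Yw we]; by exists w => //; exact: YZ.
Qed.

Section LinearClosure.
Variable Y : set (S -> K).
Hypotheses (Ylin : linear_subset Y) (Yell2 : Y `<=` ell2).

Lemma sub_closure_of : Y `<=` closure_of Y.
Proof.
move=> v Yv; split=> [|e e0]; first exact: Yell2.
exists v => //; rewrite subrr (ell2_ip_disjoint laws) // => x; by left.
Qed.

Lemma closure_of_linear : linear_subset (closure_of Y).
Proof.
split; first by apply: sub_closure_of; case: Ylin.
move=> a u v [lu uY] [lv vY]; split; first exact: (proj2 (ell2_linear K S)).
move=> e e0; have a1 : 0 < `|a| ^+ 2 + 1 by rewrite ltr_wpDl ?exprn_ge0.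
(* [ell2_norm_lin] doubles the sum of two errors, so each may be [e / 4]; the added 1 keeps the
   divisor nonzero when [a] is 0. *)
have [|w Yw uw] := uY (e / (4 * (`|a| ^+ 2 + 1))).
  by rewrite divr_gt0 // mulr_gt0.
have [|w' Yw' vw'] := vY (e / 4); first by rewrite divr_gt0.
exists (a *: w + w'); first exact: (proj2 Ylin).
have -> : a *: u + v - (a *: w + w') = a *: (u - w) + (v - w').
  by rewrite scalerBr opprD addrACA.
have luw : ell2 (u - w) by apply: (linear_subsetB (ell2_linear K S)) => //; exact: Yell2.
have lvw : ell2 (v - w') by apply: (linear_subsetB (ell2_linear K S)) => //; exact: Yell2.
apply: le_lt_trans (ell2_norm_lin laws a luw lvw) _.
have -> : e = 2 * (e / 4 + e / 4) by field.
rewrite ltr_pM2l // ler_ltD //.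
apply: (@le_trans _ _ ((`|a| ^+ 2 + 1) * N (u - w))).
  by rewrite ler_wpM2r ?lerDl // (ell2_norm_ge0 laws).
have -> : e / 4 = (`|a| ^+ 2 + 1) * (e / (4 * (`|a| ^+ 2 + 1))).
  by field; rewrite lt0r_neq0.
by rewrite ler_wpM2l // ltW.
Qed.

Lemma closure_of_trans Z : Z `<=` closure_of Y -> closure_of Z `<=` closure_of Y.
Proof.
move=> ZY v [lv vZ]; split=> // e e0.
have e4 : 0 < e / 4 by rewrite divr_gt0.
have [z Zz vz] := vZ _ e4; have [lz /(_ _ e4)[w Yw zw]] := ZY z Zz.
exists w => //; have -> : v - w = 1 *: (v - z) + (z - w).
  by rewrite scale1r addrA subrK.
have lvz : ell2 (v - z) by apply: (linear_subsetB (ell2_linear K S)).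
have lzw : ell2 (z - w) by apply: (linear_subsetB (ell2_linear K S)) => //; exact: Yell2.
apply: le_lt_trans (ell2_norm_lin laws 1 lvz lzw) _.
have -> : e = 2 * (e / 4 + e / 4) by field.
by rewrite normr1 expr1n mul1r ltr_pM2l // ltrD.
Qed.

(** Finite truncations of [v] combine unit vectors at points of its support. Density questions thus
    reduce to single points. *)
Lemma ell2_closure_of v : ell2 v ->
  (forall s, v s != 0 -> closure_of Y (e_ s)) -> closure_of Y v.
Proof.
move=> lv vY; apply: (@closure_of_trans (closure_of Y)) => //; split=> // e e0.
have [J vJ] := ell2_truncation laws lv e0.
exists (\sum_(s <- J) v s *: e_ s) => //.
apply: linear_subset_sum; first exact: closure_of_linear.
move=> s _; have [->|vs] := eqVneq (v s) 0.
  by rewrite scale0r; case: closure_of_linear.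
by apply: linear_subsetZ; [exact: closure_of_linear|exact: vY].
Qed.
End LinearClosure.

(** On [ell2], the orthogonal projection onto the functions supported in [G]. *)
Definition restr G u : S -> K := fun s => if `[< G s >] then u s else 0.

Lemma restr_linear G a u v : restr G (a *: u + v) = a *: restr G u + restr G v.
Proof.
apply/funext => s; rewrite /restr.
transitivity (a * (if `[< G s >] then u s else 0) + if `[< G s >] then v s else 0) => //.
by case: ifP => // _; rewrite mulr0 addr0.
Qed.

Lemma restr_norm_le G u : ell2 u -> N (restr G u) <= N u.
Proof.
apply: (ell2_norm_le laws) => s; rewrite /restr; case: ifP => // _.
by rewrite normr0.
Qed.

Lemma ell2_countable_supp u : ell2 u -> countable (supp u).
Proof.
move=> lu; apply: (@sub_countable _ _ _ [set x | setT x /\ u x != 0]).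
  by apply: subset_card_le => x; split.
apply: (@countable_nonzero _ setT u (N u)) => J _.
by rewrite -partial_sumE; exact: (ell2_norm_ub laws).
Qed.

Section Orthonormal.
Variable B : set (S -> K).
Hypotheses (Bell2 : B `<=` ell2) (Bon : orthonormal ip B).

Definition proj J u := \sum_(b <- J) ip u b *: b.

Lemma proj_linear_span J u : linear_span [set` J] (proj J u).
Proof.
rewrite /proj big_seq; apply: linear_subset_sum => [|b bJ].
  exact: linear_span_linear.
by apply: linear_subsetZ; [exact: linear_span_linear|exact: sub_linear_span].
Qed.

Lemma linear_span_ell2 : linear_span B `<=` ell2.
Proof. by apply: linear_span_min => //; exact: ell2_linear. Qed.

Lemma proj_ell2 J u : [set` J] `<=` B -> ell2 (proj J u).
Proof.
by move=> JB; apply/linear_span_ell2/(linear_spanS JB)/proj_linear_span.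
Qed.

Lemma ip_proj_seq (r : seq (S -> K)) u w : {subset r <= mem B} -> ell2 w ->
  ip (\sum_(b <- r) ip u b *: b) w = \sum_(b <- r) ip u b * ip b w.
Proof.
move=> + lw; elim: r => [_|b r IHr rB].
  by rewrite !big_nil (ell2_ip_disjoint laws) // => x; left.
have bB : B b by apply/set_mem/rB; rewrite mem_head.
have {}rB : {subset r <= mem B} by move=> x xr; apply: rB; rewrite inE xr orbT.
rewrite !big_cons (ell2_ip_lin laws) ?IHr //; first exact: Bell2.
rewrite big_seq; apply: (linear_subset_sum (ell2_linear K S)) => c cr.
by apply: (linear_subsetZ (ell2_linear K S)); apply/Bell2/set_mem/rB.
Qed.

Lemma ip_proj J u w : [set` J] `<=` B -> ell2 w ->
  ip (proj J u) w = \sum_(b <- J) ip u b * ip b w.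
Proof.
by move=> JB; apply: ip_proj_seq => b bJ; apply: mem_set; exact: JB.
Qed.

Lemma ip_residual J u b : [set` J] `<=` B -> ell2 u -> b \in J ->
  ip (u - proj J u) b = 0.
Proof.
move=> JB lu bJ; have Bb := JB b bJ; have lb := Bell2 Bb.
rewrite addrC -scaleN1r (ell2_ip_lin laws) //; last exact: proj_ell2.
rewrite ip_proj // (big_fsetD1 b) //= (Bon Bb Bb) eqxx mulr1 big1_fset.
  by rewrite addr0 mulN1r addNr.
move=> c; rewrite !inE => /andP[cb cJ] _.
by rewrite (Bon (JB c cJ) Bb) (negbTE cb) mulr0.
Qed.

(** The residual is orthogonal to the projection, so the difference of the two sides is its squared
    norm. *)
Lemma bessel J u : [set` J] `<=` B -> ell2 u ->
  \sum_(b <- J) `|ip u b| ^+ 2 <= N u.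
Proof.
move=> JB lu; have lp := proj_ell2 u JB.
have lr : ell2 (u - proj J u) by apply: (linear_subsetB (ell2_linear K S)).
have rp : ip (proj J u) (u - proj J u) = 0.
  rewrite ip_proj // big1_fset // => b bJ _.
  rewrite (ell2_ip_conj laws lr (Bell2 (JB b bJ))) ip_residual //.
  by rewrite (conj0 laws) mulr0.
have rE : u - proj J u = -1 *: proj J u + u by rewrite scaleN1r addrC.
have ru : ip (u - proj J u) u = N (u - proj J u).
  rewrite (ell2_ip_conj laws lu lr) (ell2_ip_conj laws lr lr); congr (conj _).
  by rewrite {2}rE (ell2_ip_lin laws _ lp lu lr) rp mulr0 add0r.
rewrite -subr_ge0; apply: le_trans (ell2_norm_ge0 laws lr) _.
rewrite -ru rE (ell2_ip_lin laws _ lp lu lu) ip_proj // mulN1r addrC lerD2l lerN2.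
rewrite big_seq [leRHS]big_seq; apply: ler_sum => b bJ.
by rewrite (ell2_ip_conj laws lu (Bell2 (JB b bJ))) (mul_conj laws).
Qed.

Lemma ip_unit_vector s u : ip (e_ s) u = conj (u s).
Proof.
apply: has_sum_sum; apply: (@cvg_near_cst _ _ _ _ _ totally_filter).
exists [fset s]%fset => // J /=; rewrite fsub1set => sJ; rewrite partial_sumE (big_fsetD1 s) //= /unit_vector.
rewrite eqxx mul1r big1_fset ?addr0 // => x; rewrite !inE => /andP[/negbTE -> _] _.
by rewrite mul0r.
Qed.

(** Bessel's inequality for the unit vector at [s], whose coefficient at [b] is the conjugate of
    [b s], bounds the finite sums of [|b s| ^+ 2]. *)
Lemma countable_orthonormal_point s : countable [set b | B b /\ b s != 0].
Proof.
apply: (@countable_nonzero _ _ (fun b => b s) (N (e_ s))) => J JB.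
apply: le_trans (bessel JB (ell2_unit_vector K s)).
rewrite big_seq [leRHS]big_seq; apply: ler_sum => b _.
by rewrite ip_unit_vector (norm_conj laws).
Qed.

End Orthonormal.

Definition approximable X s G : Prop := closure_of (down X G) (e_ s).

Section Subspace.
Variable X : set (S -> K).
Hypotheses (Xlin : linear_subset X) (Xell2 : X `<=` ell2).

Lemma down_linear G : linear_subset (down X G).
Proof.
split; first by split=> [|s]; [case: Xlin|rewrite /supp /= eqxx].
move=> a u v [Xu uG] [Xv vG]; split; first exact: (proj2 Xlin).
move=> s; apply: contraPP => nGs /=; apply/negP/negPn/eqP.
have us : u s = 0 by apply: contrapT => /eqP /uG.
have vs : v s = 0 by apply: contrapT => /eqP /vG.
by transitivity (a * u s + v s) => //; rewrite us vs mulr0 addr0.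
Qed.

Lemma down_ell2 G : down X G `<=` ell2.
Proof. by move=> u [/Xell2]. Qed.

Lemma downS G H : G `<=` H -> down X G `<=` down X H.
Proof. by move=> GH u [Xu uG]; split=> //; exact: subset_trans GH. Qed.

Lemma approximableS s G H : G `<=` H -> approximable X s G -> approximable X s H.
Proof. by move=> GH; apply/closure_ofS/downS. Qed.

(* Points are related when they lie in the support of a common basis vector:   *)
(* a basis vector is then supported inside or outside a closed set, so cutting *)
(* down to such a set maps the span of the basis to itself.                    *)
Lemma orthonormal_basis_covers (u g v : set S) B :
  orthonormal_basis ip (down X u) B -> g `<=` u ->
  (forall s, v s -> approximable X s g) ->
  exists E, covers (approximable X) E v.
Proof.
move=> [BX Bon Bdense] gu vg.
have Bell2 : B `<=` ell2 := subset_trans BX (down_ell2 (G := u)).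
exists (fun s => [set t | exists b, [/\ B b, b s != 0 & b t != 0]]); split.
  split=> [s t [b [Bb bs bt]]|s]; first by exists b.
  apply: (@sub_countable _ _ _ (\bigcup_(b in [set b | B b /\ b s != 0]) supp b)).
    by apply: subset_card_le => t [b [Bb bs bt]]; exists b.
  apply: bigcup_countable; first exact: countable_orthonormal_point.
  by move=> b [/Bell2 lb _]; exact: ell2_countable_supp.
move=> s G /vg sg Gs Gcl; split; first exact: ell2_unit_vector.
have ucl : closure_of (linear_span B) (e_ s).
  have Bcl := dense_in_closure Bdense (down_ell2 (G := u)).
  have trans := closure_of_trans (linear_span_ell2 Bell2).
  exact: trans Bcl _ (closure_ofS (downS gu) sg).
move=> e e0; have [w Bw we] := proj2 ucl e e0.
have restrX : linear_subset [set w | down X G (restr G w)].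
  split=> [|a p q /= pX qX]; last by rewrite restr_linear; exact: (proj2 (down_linear G)).
  rewrite /= (_ : restr G 0 = 0); first by case: (down_linear G).
  by apply/funext => t; rewrite /restr; case: ifP.
exists (restr G w).
  apply: (linear_span_min restrX) Bw => b Bb /=.
  have [[t [Gt bt]]|nG] := pselect (exists t, G t /\ b t != 0).
    have bG : supp b `<=` G.
      by move=> t' bt'; apply: (Gcl t) => //; exists b.
    suff -> : restr G b = b by split=> //; case: (BX b Bb).
    apply/funext => t'; rewrite /restr; case: asboolP => // nGt'.
    by apply/esym/eqP; apply: contrapT => /negP /bG.
  suff -> : restr G b = 0 by case: (down_linear G).
  apply/funext => t; rewrite /restr; case: asboolP => // Gt.
  by apply/eqP; apply: contrapT => /negP bt; apply: nG; exists t.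
(* As [s] lies in [G], cutting down to [G] fixes its unit vector; and cutting down does not increase
   norms. *)
have -> : e_ s - restr G w = restr G (e_ s - w).
  apply/funext => t; rewrite /restr.
  transitivity (e_ s t - (if `[< G t >] then w t else 0)) => //.
  case: asboolP => // nGt; rewrite subr0 /unit_vector.
  by case: eqP => // ts; case: nGt; rewrite ts.
apply: le_lt_trans we; apply: restr_norm_le.
apply: (linear_subsetB (ell2_linear K S)); first exact: ell2_unit_vector.
exact: linear_span_ell2 Bw.
Qed.

End Subspace.
End Geometry.

(** * Connected components of a symmetric relation *)

Section Components.
Variables (T : Type) (E : T -> set T).
Hypothesis Esc : symmetric_countable E.

(** The ends of walks of length exactly [n] from [s], rather than the points at distance [n]. *)
Fixpoint sphere n s : set T :=
  if n is m.+1 then \bigcup_(x in sphere m s) E x else [set s].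

Definition component s : set T := \bigcup_n sphere n s.

Lemma component_refl s : component s s.
Proof. by exists 0%N. Qed.

Lemma component_closed s : closed_under E (component s).
Proof. by move=> t y [n _ nt] Ety; exists n.+1 => //; exists t. Qed.

Lemma component_countable s : countable (component s).
Proof.
apply: bigcup_countable => // n _; elim: n => [|n IHn] /=; first exact: countable1.
by apply: bigcup_countable => // t _; case: Esc.
Qed.

Lemma component_sub s t : component s t -> component t `<=` component s.
Proof.
move=> st x [n _]; elim: n x => [x ->//|n IHn x [y /IHn sy]].
exact: component_closed sy.
Qed.

Lemma component_sym s t : component s t -> component t s.
Proof.
case=> n _; elim: n t => [t ->|n IHn t [x /IHn xs Ext]]; first exact: component_refl.
apply: component_sub xs; apply: (@component_closed t t x (component_refl t)).
exact: (proj1 Esc).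
Qed.

Lemma component_eq s t : component s t -> component t = component s.
Proof.
move=> st; apply/seteqP; split; first exact: component_sub.
exact/component_sub/component_sym.
Qed.
End Components.

(** * Gram-Schmidt and the basis obtained from a cover *)

Section Bases.
Variables (R : realType) (K : numFieldType) (conj : K -> K).
Variables (iota : {rmorphism R -> K}) (laws : scalar_laws conj iota).
Variable S : choiceType.
Implicit Types (u v w : S -> K) (J L : {fset S -> K}) (X Y Z B : set (S -> K)).
Implicit Types (G : set S) (s t : S).

Local Notation ell2 := (ell2 K S).
Local Notation ip := (ell2_ip conj S).
Local Notation N u := (ip u u).
Local Notation e_ s := (unit_vector K s).

Lemma normalize u : ell2 u -> u <> 0 -> exists c, N (c *: u) = 1.
Proof.
move=> lu u0; have Nu0 := ell2_norm_ge0 laws lu.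
have [r rE] := iota_onto laws Nu0.
have r0 : 0 <= r by rewrite -(iota_le laws) rmorph0 -rE.
have rn0 : r != 0.
  apply/eqP => re0; apply: u0; apply: (ell2_norm_eq0 laws lu).
  by rewrite rE re0 rmorph0.
exists (iota (Num.sqrt r)^-1).
have ipZ v w a : ell2 v -> ell2 w -> ip (a *: v) w = a * ip v w.
  move=> lv lw; rewrite -[a *: v]addr0 (ell2_ip_lin laws) //; last first.
    by case: (ell2_linear K S).
  by rewrite (ell2_ip_disjoint laws (u := 0)) ?addr0 // => x; left.
set c := iota _; have lcu : ell2 (c *: u) by apply: (linear_subsetZ (ell2_linear K S)).
rewrite ipZ // (ell2_ip_conj laws lcu lu) ipZ // (conjM laws).
rewrite -(ell2_ip_conj laws lu lu) mulrA (mul_conj laws) rE.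
rewrite ger0_norm; last first.
  by rewrite /c -(rmorph0 iota) (iota_le laws) invr_ge0 sqrtr_ge0.
by rewrite -rmorphXn /= -rmorphM /= exprVn sqr_sqrtr // mulVf // rmorph1.
Qed.

Lemma gram_schmidt_step Y L y : linear_subset Y -> Y `<=` ell2 -> Y y ->
  [set` L] `<=` Y -> orthonormal ip [set` L] ->
  exists L', [/\ [set` L] `<=` [set` L'], [set` L'] `<=` Y,
    orthonormal ip [set` L'] & linear_span [set` L'] y].
Proof.
move=> Ylin Yell2 Yy LY Lon.
have Lell2 : [set` L] `<=` ell2 by exact: subset_trans Yell2.
have pL := proj_linear_span conj L y.
have [yp|ynp] := pselect (y - proj conj L y = 0).
  by exists L; split=> //; move/eqP: yp; rewrite subr_eq0 => /eqP ->.
have lr : Y (y - proj conj L y).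
  by apply: linear_subsetB => //; exact: (linear_span_min Ylin LY).
have [c Nb] := normalize (Yell2 _ lr) ynp.
set b := c *: _ in Nb; have Yb : Y b by exact: linear_subsetZ.
have lb := Yell2 _ Yb.
have bl l : [set` L] l -> ip b l = 0.
  move=> Ll; rewrite /b -[c *: _]addr0 (ell2_ip_lin laws) //.
  - rewrite (ip_residual laws Lell2 Lon) // ?mulr0 ?add0r; last exact: Yell2.
    by apply: (ell2_ip_disjoint laws) => x; left.
  - exact: Yell2.
  - by case: (ell2_linear K S).
  - exact: Lell2.
have lb0 l : [set` L] l -> ip l b = 0.
  by move=> Ll; rewrite (ell2_ip_conj laws lb (Lell2 _ Ll)) bl // (conj0 laws).
have nbL l : [set` L] l -> (b == l) = false.
  move=> Ll; apply/eqP => bE; have := bl l Ll; rewrite -bE Nb => /eqP.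
  by rewrite oner_eq0.
exists (b |` L)%fset; split.
- by move=> l /= Ll; rewrite !inE Ll orbT.
- by move=> l /=; rewrite !inE => /orP[/eqP ->//|]; exact: LY.
- move=> l m /=; rewrite !inE => /orP[/eqP ->|Ll] /orP[/eqP ->|Lm].
  + by rewrite eqxx Nb.
  + by rewrite bl // nbL.
  + by rewrite lb0 // eq_sym nbL.
  + exact: Lon.
have Slin := linear_span_linear [set` (b |` L)%fset].
rewrite -[y](subrK (proj conj L y)); apply: (linear_subsetD Slin); last first.
  by apply: linear_spanS pL => l /= Ll; rewrite !inE Ll orbT.
have c0 : c != 0.
  apply/eqP => c0; move: Nb; rewrite /b c0 scale0r.
  rewrite (ell2_ip_disjoint laws) => [/eqP|x]; last by left.
  by rewrite eq_sym oner_eq0.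
have -> : y - proj conj L y = c^-1 *: b by rewrite /b scalerA mulVf // scale1r.
apply: (linear_subsetZ Slin); apply: sub_linear_span.
by rewrite /= !inE eqxx.
Qed.

(** Every new vector is a finite combination of elements of [Y], so [B] stays inside [Y] without any
    completeness. This is why countably generated spaces are never pathological. *)
Lemma gram_schmidt Y Q : linear_subset Y -> Y `<=` ell2 -> Q `<=` Y ->
  countable Q ->
  exists B, [/\ B `<=` Y, orthonormal ip B & Q `<=` linear_span B].
Proof.
move=> Ylin Yell2 QY /(card_le_exinj 0%N)[f _ finj].
pose ok L := [set` L] `<=` Y /\ orthonormal ip [set` L].
have /choice[F FP] : forall p : {fset S -> K} * (S -> K), exists L', ok p.1 -> Y p.2 ->
    [/\ [set` p.1] `<=` [set` L'], ok L' & linear_span [set` L'] p.2].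
  move=> [L y] /=; have [[[LY Lon] Yy]|nL] := pselect (ok L /\ Y y).
    by have [L' [? ? ? ?]] := gram_schmidt_step Ylin Yell2 Yy LY Lon; exists L'.
  by exists L => okL Yy; case: nL.
pose y n := xget 0 [set q | Q q /\ f q = n].
have Yy n : Y (y n).
  have [ne|ne] := pselect (exists q, Q q /\ f q = n).
    by have [/QY] := xgetPex 0 ne.
  rewrite /y xgetPN; first by case: Ylin.
  by move=> q qn; apply: ne; exists q.
pose fix L n := if n is m.+1 then F (L m, y m) else fset0.
have okL n : ok (L n).
  elim: n => [|n IHn] /=; first by split=> [l|l m]; rewrite /= inE.
  by have [] := FP (L n, y n) IHn (Yy n).
have LS n := FP (L n, y n) (okL n) (Yy n).
have Lmono m n : (m <= n)%N -> [set` L m] `<=` [set` L n].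
  elim: n => [|n IHn]; first by rewrite leqn0 => /eqP ->.
  rewrite leq_eqVlt => /orP[/eqP -> //|]; rewrite ltnS => /IHn mn.
  by apply: subset_trans mn _; case: (LS n).
exists (\bigcup_n [set` L n]); split.
- by move=> b [n _]; case: (okL n) => + _; apply.
- move=> b c [m _ Lb] [n _ Lc]; have [_] := okL (maxn m n); apply.
    by apply: Lmono Lb; exact: leq_maxl.
  by apply: Lmono Lc; exact: leq_maxr.
move=> q Qq; have -> : q = y (f q).
  have [Qy fy] : [set q' | Q q' /\ f q' = f q] (y (f q)).
    by apply: xgetPex; exists q.
  exact: finj.
have [_ _ spanL] := LS (f q); apply: linear_spanS spanL => b Lb.
by exists (f q).+1.
Qed.

Lemma real_small e : 0 < e -> exists n, n.+1%:R^-1 <= e :> K.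
Proof.
move=> e0; have [r rE] := iota_onto laws (ltW e0).
have r0 : 0 < r by rewrite -(iota_gt0 laws) -rE.
pose n := Num.bound r^-1; exists n; rewrite rE.
have -> : n.+1%:R^-1 = iota n.+1%:R^-1 by rewrite fmorphV rmorph_nat.
rewrite (iota_le laws) -[leRHS]invrK lef_pV2 ?posrE ?invr_gt0 //.
apply/ltW/(lt_le_trans (archi_boundP _)); first by rewrite invr_ge0 ltW.
by rewrite ler_nat.
Qed.

Section Subspace.
Variable X : set (S -> K).
Hypotheses (Xlin : linear_subset X) (Xell2 : X `<=` ell2).

(** Countably many vectors, one for each point of [G] and each error [n.+1%:R^-1], suffice to
    approximate the unit vectors; Gram-Schmidt applies to them. *)
Lemma countable_approximable_basis G : countable G ->
  (forall s, G s -> approximable conj X s G) ->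
  exists B, [/\ B `<=` down X G, orthonormal ip B &
    forall s, G s -> closure_of conj (linear_span B) (e_ s)].
Proof.
move=> cG Gapprox.
have dlin := down_linear Xlin G; have dell2 := down_ell2 Xell2 (G := G).
have /choice[x xP] : forall p : S * nat, exists x, G p.1 ->
    down X G x /\ N (e_ p.1 - x) < p.2.+1%:R^-1.
  move=> [s n] /=; have [/Gapprox[_ /(_ n.+1%:R^-1)]|nG] := pselect (G s).
    by case; rewrite ?invr_gt0 // => x dx Nx; exists x.
  by exists 0.
have [||B [BY Bon QB]] := gram_schmidt dlin dell2 (Q := x @` (G `*` setT)).
- by move=> _ [p [Gp _] <-]; case: (xP p Gp).
- by apply: sub_countable (card_image_le _ _) _; exact: countableX.
exists B; split=> // s Gs; split; first exact: ell2_unit_vector.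
move=> e /real_small[n ne]; exists (x (s, n)); first by apply: QB; exists (s, n).
by have [_] := xP (s, n) Gs; move/lt_le_trans; apply.
Qed.

(** A component is countable and closed, so its points are approximable in it and it has a basis of
    its own. Vectors from different components have disjoint supports, hence are orthogonal, and the
    union of the bases approximates every unit vector. *)
Lemma covers_orthonormal_basis E : covers (approximable conj X) E setT ->
  exists B, orthonormal_basis ip X B.
Proof.
move=> [Esc Eapprox].
(* The basis is chosen as a function of the set [G], so that all points of a component get the same
   one. *)
have /choice[b bP] : forall G, exists B, countable G ->
    (forall s, G s -> approximable conj X s G) ->
    [/\ B `<=` down X G, orthonormal ip B &
      forall s, G s -> closure_of conj (linear_span B) (e_ s)].
  move=> G; have [[cG /(countable_approximable_basis cG)[B BP]]|nG] := pselect
    (countable G /\ forall s, G s -> approximable conj X s G); first by exists B.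
  by exists set0 => cG Ga; case: nG.
pose C := component E.
have {}bP s : [/\ b (C s) `<=` down X (C s), orthonormal ip (b (C s)) &
    forall t, C s t -> closure_of conj (linear_span (b (C s))) (e_ t)].
  apply: bP; first exact: component_countable.
  by move=> t Ct; apply: Eapprox => //; exact: component_closed.
have bX : \bigcup_s b (C s) `<=` X.
  by move=> c [s _]; case: (bP s) => + _ _ => /(_ c) h /h[].
have sX : linear_span (\bigcup_s b (C s)) `<=` X by exact: linear_span_min.
exists (\bigcup_s b (C s)); split=> //; last first.
  apply: closure_dense_in => // v Xv.
  apply: (ell2_closure_of laws (linear_span_linear _) (subset_trans sX Xell2)).
    exact: Xell2.
  move=> s _; have [_ _ /(_ s (component_refl E s))] := bP s.
  by apply/closure_ofS/linear_spanS => c bc; exists s.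
move=> c c' [s _ bc] [t _ bc'].
have [/(_ c bc)[_ cs] on _] := bP s; have [/(_ c' bc')[_ ct] on' _] := bP t.
have [st|nst] := pselect (exists x, C s x /\ C t x).
  case: st => x [sx tx].
  suff st : C s = C t by apply: on => //; rewrite st.
  by rewrite /C -(component_eq Esc sx) (component_eq Esc tx).
have disj : ip c c' = 0.
  apply: (ell2_ip_disjoint laws) => x.
  have [->|cx] := eqVneq (c x) 0; [by left|right].
  apply: contrapT => /eqP c'x; apply: nst; exists x.
  by split; [exact: cs|exact: ct].
rewrite disj; case: eqP => // cc'; move: disj; rewrite -cc'.
by rewrite (on c c bc bc) eqxx => /eqP; rewrite oner_eq0.
Qed.
End Subspace.
End Bases.

(** * Stationarity of the pathological restrictions *)

Lemma card_le_setU_below (d : Order.disp_t) (lam : orderType d)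
    (lam_wo : wochoice.well_order (fun x y : lam => (x <= y)%O)) (mu : lam)
    (T : Type) (A B : set T) : infinite_set (below mu) ->
  (A #<= below mu)%card -> (B #<= below mu)%card ->
  (A `|` B #<= below mu)%card.
Proof.
move=> mu_inf Amu Bmu; have [x _] := infinite_setN0 mu_inf.
rewrite -bigcup2E; apply: card_le_trans (card_below_sq lam_wo mu_inf).
have /infiniteP natmu := mu_inf.
apply: card_le_trans (card_le_setX natmu (card_lexx (below mu))).
apply: (bigcup_card_le 0%N x) => -[|[|n]] _ //=; exact: card_ge0.
Qed.

Theorem theorem7p1 (R : realType) (K : numFieldType) (conj : K -> K)
    (hK : real_or_complex R conj)
    (d : Order.disp_t) (lam : orderType d) (hlam : singular_cardinal lam)
    (X : set (lam -> K))
    (hX : subspace X (ell2 K lam))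
    (hdense : dense_in (ell2_ip conj lam) X (ell2 K lam))
    (hpath : pathological (ell2_ip conj lam) X) :
  exists2 lam' : lam, is_cardinal lam' &
    forall kappa : lam, is_cardinal kappa -> (lam' <= kappa)%O ->
      exists2 mu : lam, is_successor_cardinal kappa mu &
        stationary mu
          [set u | subsets_of_card mu u /\
                   pathological (ell2_ip conj lam) (down X u)].
Proof.
have [iota laws] := real_or_complex_laws hK.
have [Xell2 X0 Xclosed] := hX; have Xlin : linear_subset X by [].
have lwo := lam_wo hlam.
have [u0 [u0_small u0_uncovered]] : exists u0 : set lam,
    small lam u0 /\ ~ exists E, covers (approximable conj X) E u0.
  apply: contrapT => all_covered; apply: hpath.
  have [|u usm|E] := singular_compactness hlam (approx := approximable conj X).
  - by move=> s G H; exact: approximableS.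
  - by apply: contrapT => nu; apply: all_covered; exists u.
  - exact: (covers_orthonormal_basis laws).
(* Density of [X] gives a sequence in [X] tending to the unit vector at [s]; [h] is the union of its
   supports. *)
have /choice[h hP] : forall s, exists h, countable h /\ approximable conj X s h.
  move=> s; have eX : closure_of conj X (unit_vector K s).
    by apply: (dense_in_closure laws hdense) => //; exact: ell2_unit_vector.
  have /choice[x xP] : forall n, exists x, X x /\
      ell2_ip conj lam (unit_vector K s - x) (unit_vector K s - x) < n.+1%:R^-1.
    move=> n; have [|x Xx] := proj2 eX n.+1%:R^-1; first by rewrite invr_gt0.
    by exists x.
  exists (\bigcup_n supp (x n)); split.
    apply: bigcup_countable => // n _; apply: (ell2_countable_supp laws).
    by have [/Xell2] := xP n.
  split=> [|e /(real_small laws)[n ne]]; first exact: ell2_unit_vector.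
  have [Xx xn] := xP n; exists (x n); last exact: lt_le_trans ne.
  by split=> // t xt; exists n.
(* [lam'] is infinite and at least as large as [u0], so that [u0] many countable sets have a union
   of size at most [mu]. *)
case: u0_small => a u0a; have [b ab b_inf] := infinite_below_ge hlam a.
have [lam' lam'_card bl] := ex_cardinal hlam b; exists lam' => // k k_card lk.
have [mu mu_succ kmu] := ex_successor_cardinal hlam k; exists mu => //.
have bmu : (below b #<= below mu)%card.
  apply: card_le_trans bl (card_le_trans _ kmu).
  by apply: subset_card_le; exact: belowS.
have mu_inf : infinite_set (below mu) by move=> /(card_le_finite bmu).
have natmu : ([set: nat] #<= below mu)%card by exact/infiniteP.
split=> [u []//|C [C_card C_cof _]].
pose g := \bigcup_(s in u0) h s.
have gmu : (g #<= below mu)%card.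
  have gx : (g #<= u0 `*` [set: nat])%card.
    by apply: (bigcup_card_le a 0%N) => s _; case: (hP s).
  apply: card_le_trans gx (card_le_trans _ (card_below_sq lwo mu_inf)).
  apply: card_le_setX natmu; apply: card_le_trans u0a (card_le_trans _ bmu).
  by apply: subset_card_le; exact: belowS.
(* Adding [below mu] brings [g] to cardinality exactly [mu], as cofinality of [C] requires. *)
have [|u Cu gu] := C_cof (g `|` below mu).
  rewrite /subsets_of_card /= card_eq_le card_le_setU_below //.
  by apply: subset_card_le; exact: subsetUr.
exists u; split=> //; split; first exact: C_card.
case=> B Bbasis; apply: u0_uncovered.
apply: (orthonormal_basis_covers laws Xlin Xell2 Bbasis (g := g)).
  by move=> s gs; apply: gu; left.
move=> s u0s; apply: approximableS (proj2 (hP s)).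
by move=> t ht; exists s.
Qed.
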